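(* Let \(\Gamma\) be a set of Horn clauses over a signature \(\Delta\), let \(\Gamma_0 = \{\rho \mid \rho \text{ atomic sentence over } \Delta,\ \Gamma \models \rho\}\), and let \((W^{\Gamma_0}, M^{\Gamma_0})\) be a reachable initial model of \(\Gamma_0\). Then \((W^{\Gamma_0}, M^{\Gamma_0})\) is also an initial model of \(\Gamma\).
   Context: Signatures: \(\Delta = (\Sigma^{n}, \Sigma^{r} \subseteq \Sigma)\), where \(\Sigma^{n} = (\{\star\}, F^{n}, P^{n})\) is a one-sorted first-order signature of nominals and \(\Sigma^{r} = (S^{r},F^{r},P^{r}) \subseteq \Sigma = (S,F,P)\) are many-sorted first-order signatures; symbols in \(\Sigma^{r}\) are rigid, the others (\(F^{f}, P^{f}\)) flexible. A \(\Delta\)-model is \((W,M)\) with \(W\) a \(\Sigma^{n}\)-model, \(|W|\) the carrier of \(\star\) (worlds), and \(M=\{M_w\}_{w\in|W|}\) \(\Sigma\)-models interpreting all rigid symbols identically. A \(\Delta\)-homomorphism \((W,M)\to(W',M')\) is a \(\Sigma^{n}\)-homomorphism \(h\colon W\to W'\) with \(\Sigma\)-homomorphisms \(h_w\colon M_w\to M'_{h(w)}\) coinciding on rigid sorts. An initial model of a set of sentences is a model of it with exactly one homomorphism into every model of it. A model is reachable if every world is the value \(W_k\) of a ground nominal term \(k\) and every element of \(M_{W_k}\) is the value of a hybrid term in \(T^{\Delta}_k\). Hybrid terms \(T^{\Delta}_k\) at a ground nominal term \(k\): least family with \(\sigma(t)\in T^{\Delta}_{k,s}\) for rigid \(\sigma\in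 F^{r}_{ar\to s}\), \(\sigma(k,t)\in T^{\Delta}_{k,s}\) for flexible \(\sigma\), \(t\in T^{\Delta}_{k,ar}\), and \(T^{\Delta}_{k_0,s}\subseteq T^{\Delta}_{k,s}\) for rigid sorts \(s\). \((W,M)_t\in M_{W_k}\) is the value of \(t\in T^{\Delta}_k\). Atomic sentences (world-independent satisfaction): \(k_1 = k_2\) (\(W_{k_1}=W_{k_2}\)); \(\lambda(k)\), \(\lambda\in P^n\) (\(W_k\in W_\lambda\)); \(t_1 =_k t_2\) (\((W,M)_{t_1}=(W,M)_{t_2}\)); \(\varpi(t)\), \(\varpi\in P^r\) (\((W,M)_t\in M_{w,\varpi}\)); \(\pi(k,t)\), \(\pi\in P^f\) (\((W,M)_t\in M_{W_k,\pi}\)). Actions: \(\mathfrak{a} ::= \lambda \mid \mathfrak{a};\mathfrak{a} \mid \mathfrak{a}+\mathfrak{a}\mid\mathfrak{a}^*\), \(\lambda\in P^n_{\star\star}\), interpreted by composition, union, reflexive-transitive closure; action relation \(\mathfrak{a}(k_1,k_2)\) holds iff \((W_{k_1},W_{k_2})\in W_{\mathfrak{a}}\). Further sentences and satisfaction at world \(w\): \(@_k\gamma\): \(\gamma\) holds at \(W_k\); implication as usual; \(\downarrow z.\gamma\) (\(z\) a nominal variable added as a constant to \(F^n\)): \(\gamma\) holds at \(w\) in the expansion interpreting \(z\) as \(w\); \(\forall X.\gamma\) (\(X\) a set of nominal variables and variables of rigid sorts, added as new constants to \(F^n\), resp. \(F^r\)): \(\gamma\) holds at \(w\) in every \(\Delta[X]\)-expansion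 (same carriers, arbitrary values for the new constants); \([\mathfrak{a}]\gamma\): \(\gamma\) holds at all \(w'\) with \((w,w')\in W_{\mathfrak{a}}\); \(\langle\sigma\rangle\gamma\) (\(\sigma\) unary in \(F^n\)): \(\gamma\) holds at \(W_\sigma(w)\). Horn clauses: sentences obtained from atomic sentences by repeated application of \(@_k\), implication \(\bigwedge H \Rightarrow \gamma\) with \(H\) a finite set of atomic sentences or action relations, \(\downarrow z\), \(\forall X\), \([\mathfrak{a}]\), \(\langle\sigma\rangle\). \((W,M)\models\gamma\) means satisfaction at every world; \(\Gamma\models\gamma\) means every model of \(\Gamma\) satisfies \(\gamma\). *)

(* Defs.v *)
From Stdlib Require Import List Relation_Operators.
From mathcomp Require Import all_boot.

Set Implicit Arguments.
Unset Strict Implicit.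
Unset Printing Implicit Defensive.

(* The inclusion S^r <= S is presented as the disjoint sum of the rigid sorts
   [Sr] and the flexible sorts [Sf]; in the same way F is the disjoint union of
   [rigid_fun] and [flex_fun], and P that of [rigid_pred] and [flex_pred].
   Rigid symbols form a signature over Sr, so their arities only mention rigid
   sorts; arities of flexible symbols are arbitrary. *)
Definition sort (Sr Sf : Type) : Type := (Sr + Sf)%type.

Definition rigid (Sr Sf : Type) (s : Sr) : sort Sr Sf := inl s.
Arguments rigid {Sr} Sf s.

Record signature (Sr Sf : Type) : Type := Signature {
  nom_fun : nat -> Type;
  nom_pred : nat -> Type;
  rigid_fun : seq Sr -> Sr -> Type;
  rigid_pred : seq Sr -> Type;
  flex_fun : seq (sort Sr Sf) -> sort Sr Sf -> Type;
  flex_pred : seq (sort Sr Sf) -> Type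
}.

(* Arguments for an arity are functions on positions, and [arg ar i] is the
   sort at position i of the word ar. *)
Definition arg (S : Type) (ar : seq S) (i : 'I_(size ar)) : S :=
  tnth (in_tuple ar) i.

Record variables (Sr : Type) : Type := Variables {
  nom_var : Type;
  rigid_var : Sr -> Type
}.

Definition extend (Sr Sf : Type) (D : signature Sr Sf) (X : variables Sr) :
    signature Sr Sf :=
  Signature
    (fun n => (nom_fun D n + if n is 0 then nom_var X else void)%type)
    (nom_pred D)
    (fun ar s =>
       (rigid_fun D ar s + if ar is [::] then rigid_var X s else void)%type)
    (rigid_pred D)
    (flex_fun D)
    (flex_pred D).

Definition one_nominal (Sr : Type) : variables Sr :=
  Variables unit (fun _ => void).

(* Closed terms: in sentences, variables are constants of an extended signature. *)
Inductive nom_term (Sr Sf : Type) (D : signature Sr Sf) : Type :=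
| NomApp (n : nat) (f : nom_fun D n) (ks : 'I_n -> nom_term D).

(* [HLift] renders the inclusion of T_{k0,s} in T_{k,s} for rigid s as an
   explicit coercion; it does not change values. *)
Inductive hybrid_term (Sr Sf : Type) (D : signature Sr Sf) (k : nom_term D) :
    sort Sr Sf -> Type :=
| HRigid (ar : seq Sr) (s : Sr) (f : rigid_fun D ar s)
    (t : forall i, hybrid_term k (rigid Sf (arg (ar := ar) i))) :
    hybrid_term k (rigid Sf s)
| HFlex (ar : seq (sort Sr Sf)) (s : sort Sr Sf) (f : flex_fun D ar s)
    (t : forall i, hybrid_term k (arg (ar := ar) i)) :
    hybrid_term k s
| HLift (k0 : nom_term D) (s : Sr) (t : hybrid_term k0 (rigid Sf s)) :
    hybrid_term k (rigid Sf s).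

(* In a rigid predicate atom every argument has a rigid sort, so the nominal it
   is written at is immaterial; letting it vary with the position also covers
   nullary predicates over a signature without ground nominal terms. *)
Inductive atom (Sr Sf : Type) (D : signature Sr Sf) : Type :=
| NomEq (k1 k2 : nom_term D)
| NomPred (n : nat) (l : nom_pred D n) (ks : 'I_n -> nom_term D)
| HybEq (k : nom_term D) (s : sort Sr Sf) (t1 t2 : hybrid_term k s)
| RigidPred (ar : seq Sr) (p : rigid_pred D ar)
    (ks : 'I_(size ar) -> nom_term D)
    (t : forall i, hybrid_term (ks i) (rigid Sf (arg i)))
| FlexPred (ar : seq (sort Sr Sf)) (p : flex_pred D ar) (k : nom_term D)
    (t : forall i, hybrid_term k (arg (ar := ar) i)).

Inductive action (Sr Sf : Type) (D : signature Sr Sf) : Type :=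
| ActPred (l : nom_pred D 2)
| ActSeq (a b : action D)
| ActUnion (a b : action D)
| ActStar (a : action D).

Inductive premise (Sr Sf : Type) (D : signature Sr Sf) : Type :=
| PAtom (r : atom D)
| PAction (a : action D) (k1 k2 : nom_term D).

Inductive horn (Sr Sf : Type) (D : signature Sr Sf) : Type :=
| Atomic (r : atom D)
| At (k : nom_term D) (g : horn D)
| Imp (H : seq (premise D)) (g : horn D)
| Down (g : horn (extend D (one_nominal Sr)))
| Forall (X : variables Sr) (g : horn (extend D X))
| Box (a : action D) (g : horn D)
| Next (f : nom_fun D 1) (g : horn D).

Definition carrier (Sr Sf W : Type) (rc : Sr -> Type) (fc : W -> Sf -> Type)
    (w : W) (s : sort Sr Sf) : Type :=
  match s with inl r => rc r | inr f => fc w f end.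

(* The local models M_w share the interpretation of rigid symbols by
   construction. No carrier is assumed to be inhabited, not even [world]. *)
Record model (Sr Sf : Type) (D : signature Sr Sf) : Type := Model {
  world : Type;
  nom_fun_val : forall n, nom_fun D n -> ('I_n -> world) -> world;
  nom_pred_val : forall n, nom_pred D n -> ('I_n -> world) -> Prop;
  rigid_carrier : Sr -> Type;
  flex_carrier : world -> Sf -> Type;
  rigid_fun_val : forall (ar : seq Sr) (s : Sr), rigid_fun D ar s ->
    (forall i, rigid_carrier (arg (ar := ar) i)) -> rigid_carrier s;
  rigid_pred_val : forall ar : seq Sr, rigid_pred D ar ->
    (forall i, rigid_carrier (arg (ar := ar) i)) -> Prop;
  flex_fun_val : forall (w : world) (ar : seq (sort Sr Sf)) (s : sort Sr Sf),
    flex_fun D ar s ->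
    (forall i, carrier rigid_carrier flex_carrier w (arg (ar := ar) i)) ->
    carrier rigid_carrier flex_carrier w s;
  flex_pred_val : forall (w : world) (ar : seq (sort Sr Sf)),
    flex_pred D ar ->
    (forall i, carrier rigid_carrier flex_carrier w (arg (ar := ar) i)) -> Prop
}.

Definition elt (Sr Sf : Type) (D : signature Sr Sf) (M : model D)
    (w : world M) (s : sort Sr Sf) : Type :=
  carrier (@rigid_carrier _ _ _ M) (@flex_carrier _ _ _ M) w s.

(* [hom_rigid_sort] is typable because the carrier of a rigid sort is
   convertible at any two worlds. *)
Record hom (Sr Sf : Type) (D : signature Sr Sf) (M N : model D) : Type := Hom {
  hom_world : world M -> world N;
  hom_elt : forall (w : world M) (s : sort Sr Sf),
    elt w s -> elt (hom_world w) s;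
  hom_nom_fun : forall n (f : nom_fun D n) (ws : 'I_n -> world M),
    hom_world (nom_fun_val f ws) = nom_fun_val f (fun i => hom_world (ws i));
  hom_nom_pred : forall n (l : nom_pred D n) (ws : 'I_n -> world M),
    nom_pred_val l ws -> nom_pred_val l (fun i => hom_world (ws i));
  hom_rigid_fun : forall (w : world M) (ar : seq Sr) (s : Sr)
      (f : rigid_fun D ar s) (x : forall i, elt w (rigid Sf (arg (ar := ar) i))),
    hom_elt (s := rigid Sf s) (rigid_fun_val f x : elt w (rigid Sf s)) =
    rigid_fun_val f (fun i => hom_elt (x i));
  hom_rigid_pred : forall (w : world M) (ar : seq Sr) (p : rigid_pred D ar)
      (x : forall i, elt w (rigid Sf (arg (ar := ar) i))),
    rigid_pred_val p x -> rigid_pred_val p (fun i => hom_elt (x i));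
  hom_flex_fun : forall (w : world M) (ar : seq (sort Sr Sf)) (s : sort Sr Sf)
      (f : flex_fun D ar s) (x : forall i, elt w (arg (ar := ar) i)),
    hom_elt (flex_fun_val f x : elt w s) =
    flex_fun_val f (fun i => hom_elt (x i));
  hom_flex_pred : forall (w : world M) (ar : seq (sort Sr Sf))
      (p : flex_pred D ar) (x : forall i, elt w (arg (ar := ar) i)),
    flex_pred_val p x -> flex_pred_val p (fun i => hom_elt (x i));
  hom_rigid_sort : forall (w1 w2 : world M) (s : Sr) (x : rigid_carrier M s),
    hom_elt (x : elt w1 (rigid Sf s)) = hom_elt (x : elt w2 (rigid Sf s))
      :> rigid_carrier N s
}.

(* As [vn] and [vr] vary, these are all the expansions of M to [extend D X]. *)
Definition expand (Sr Sf : Type) (D : signature Sr Sf) (M : model D)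
    (X : variables Sr) (vn : nom_var X -> world M)
    (vr : forall s : Sr, rigid_var X s -> rigid_carrier M s) :
    model (extend D X) :=
  @Model Sr Sf (extend D X) (world M)
    (fun n f => match f with
      | inl f => nom_fun_val f
      | inr x => (match n return (if n is 0 then nom_var X else void) ->
                                 ('I_n -> world M) -> world M with
                  | 0 => fun x _ => vn x
                  | _.+1 => fun x => match x with end
                  end) x
      end)
    (@nom_pred_val _ _ D M)
    (rigid_carrier M)
    (@flex_carrier _ _ _ M)
    (fun ar s f => match f with
      | inl f => rigid_fun_val f
      | inr x => (match ar return (if ar is [::] then rigid_var X s else void) ->
                     (forall i, rigid_carrier M (arg (ar := ar) i)) ->
                     rigid_carrier M s with
                  | [::] => fun x _ => vr s x
                  | _ :: _ => fun x => match x with end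
                  end) x
      end)
    (@rigid_pred_val _ _ D M)
    (@flex_fun_val _ _ D M)
    (@flex_pred_val _ _ D M).

Fixpoint nom_val (Sr Sf : Type) (D : signature Sr Sf) (M : model D)
    (k : nom_term D) : world M :=
  match k with NomApp n f ks => nom_fun_val f (fun i => nom_val M (ks i)) end.

Fixpoint hybrid_val (Sr Sf : Type) (D : signature Sr Sf) (M : model D)
    (k : nom_term D) (s : sort Sr Sf) (t : hybrid_term k s) :
    elt (nom_val M k) s :=
  match t in hybrid_term _ s return elt (nom_val M k) s with
  | HRigid ar s f t => rigid_fun_val f (fun i => hybrid_val M (t i))
  | HFlex ar s f t => flex_fun_val f (fun i => hybrid_val M (t i))
  | HLift k0 s t => hybrid_val M t
  end.

Definition sat_atom (Sr Sf : Type) (D : signature Sr Sf) (M : model D)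
    (r : atom D) : Prop :=
  match r with
  | NomEq k1 k2 => nom_val M k1 = nom_val M k2
  | NomPred n l ks => nom_pred_val l (fun i => nom_val M (ks i))
  | HybEq k s t1 t2 => hybrid_val M t1 = hybrid_val M t2
  | RigidPred ar p ks t => rigid_pred_val p (fun i => hybrid_val M (t i))
  | FlexPred ar p k t => flex_pred_val p (fun i => hybrid_val M (t i))
  end.

Fixpoint action_val (Sr Sf : Type) (D : signature Sr Sf) (M : model D)
    (a : action D) : world M -> world M -> Prop :=
  match a with
  | ActPred l => fun w w' => nom_pred_val l (tnth [tuple w; w'])
  | ActSeq a b => fun w w' => exists v, action_val a w v /\ action_val b v w'
  | ActUnion a b => fun w w' => action_val a w w' \/ action_val b w w'
  | ActStar a => clos_refl_trans _ (@action_val _ _ _ M a)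
  end.

Definition sat_premise (Sr Sf : Type) (D : signature Sr Sf) (M : model D)
    (h : premise D) : Prop :=
  match h with
  | PAtom r => sat_atom M r
  | PAction a k1 k2 => action_val a (nom_val M k1) (nom_val M k2)
  end.

Fixpoint sat_at (Sr Sf : Type) (D : signature Sr Sf) (g : horn D) :
    forall M : model D, world M -> Prop :=
  match g with
  | Atomic r => fun M _ => sat_atom M r
  | At k g => fun M _ => sat_at g (nom_val M k)
  | Imp H g => fun M w =>
      (forall h, List.In h H -> sat_premise M h) -> sat_at g w
  | Down g => fun M w =>
      @sat_at _ _ _ g
        (@expand _ _ _ M (one_nominal Sr) (fun _ => w)
           (fun s (x : void) => match x with end)) w
  | Forall X g => fun M w =>
      forall (vn : nom_var X -> world M)
             (vr : forall s, rigid_var X s -> rigid_carrier M s),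
        @sat_at _ _ _ g (expand vn vr) w
  | Box a g => fun M w => forall w', action_val a w w' -> sat_at g w'
  | Next f g => fun M w => sat_at g (nom_fun_val f (fun _ => w))
  end.

Definition sat (Sr Sf : Type) (D : signature Sr Sf) (M : model D)
    (g : horn D) : Prop :=
  forall w : world M, sat_at g w.

Definition sat_set (Sr Sf : Type) (D : signature Sr Sf) (M : model D)
    (G : horn D -> Prop) : Prop :=
  forall g, G g -> sat M g.

Definition entails (Sr Sf : Type) (D : signature Sr Sf) (G : horn D -> Prop)
    (g : horn D) : Prop :=
  forall M : model D, sat_set M G -> sat M g.

Definition atomic_consequences (Sr Sf : Type) (D : signature Sr Sf)
    (G : horn D -> Prop) (g : horn D) : Prop :=
  exists2 r : atom D, g = Atomic r & entails G (Atomic r).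

Definition initial_model (Sr Sf : Type) (D : signature Sr Sf)
    (G : horn D -> Prop) (M : model D) : Prop :=
  sat_set M G /\
  forall N : model D, sat_set N G ->
    exists h : hom M N, forall h' : hom M N, h' = h.

Definition reachable (Sr Sf : Type) (D : signature Sr Sf) (M : model D) : Prop :=
  (forall w : world M, exists k : nom_term D, nom_val M k = w) /\
  (forall (k : nom_term D) (s : sort Sr Sf) (x : elt (nom_val M k) s),
     exists t : hybrid_term k s, hybrid_val M t = x).

(* Main.v *)
(* Every model N of Gamma is a model of Gamma_0, so initiality of M yields a
   homomorphism M -> N, and only M |= Gamma has to be shown.  Reachability makes
   the homomorphisms from M to models of Gamma jointly reflect atomic facts:
   facts about elements of M are atomic sentences, and those true in
   every model of Gamma hold in M.  Thus M is embedded in the product of the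
   models of Gamma, and Horn clauses are inherited along such embeddings.
   Phrasing reflection with elements rather than terms makes it stable under
   expansions, so that no substitution of terms for variables is needed. *)

From Stdlib Require Import Relation_Operators FunctionalExtensionality.
From mathcomp Require Import all_boot.
Require Import Defs.

Set Implicit Arguments.
Unset Strict Implicit.
Unset Printing Implicit Defensive.

Section HomPreservation.
Variables (Sr Sf : Type) (D : signature Sr Sf) (M N : model D) (h : hom M N).

Lemma hom_nom_val (k : nom_term D) : hom_world h (nom_val M k) = nom_val N k.
Proof.
elim: k => n f ks IH /=; rewrite hom_nom_fun.
by congr (nom_fun_val f _); apply: functional_extensionality.
Qed.

(** The worlds [hom_world h (nom_val M k)] and [nom_val N k] are equal but not convertible, so the
    image of a value has to be carried along that equation. *)
Definition transport (w w' : world N) (e : w = w') (s : sort Sr Sf)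
    (x : elt w s) : elt w' s :=
  eq_rect w (fun v => elt v s) x w' e.

Lemma transport_rigid (w w' : world N) (e : w = w') (s : Sr)
    (x : elt w (rigid Sf s)) : transport e x = x :> rigid_carrier N s.
Proof. by case: w' / e. Qed.

Lemma transport_flex_fun (w w' : world N) (e : w = w') ar s
    (f : flex_fun D ar s) (x : forall i, elt w (arg (ar := ar) i)) :
  transport e (flex_fun_val f x : elt w s) =
  flex_fun_val f (fun i => transport e (x i)).
Proof. by case: w' / e. Qed.

Lemma transport_flex_pred (w w' : world N) (e : w = w') ar
    (p : flex_pred D ar) (x : forall i, elt w (arg (ar := ar) i)) :
  flex_pred_val p (fun i => transport e (x i)) <-> flex_pred_val p x.
Proof. by case: w' / e. Qed.

Lemma hom_hybrid_val (k : nom_term D) s (t : hybrid_term k s) :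
  transport (hom_nom_val k) (hom_elt h (hybrid_val M t)) = hybrid_val N t.
Proof.
elim: t => {k s} [k ar s f t IH|k ar s f t IH|k k0 s t IH] /=.
- rewrite [LHS]transport_rigid hom_rigid_fun.
  congr (rigid_fun_val f _); apply: functional_extensionality_dep => i.
  by rewrite -IH [RHS]transport_rigid.
- rewrite hom_flex_fun transport_flex_fun.
  congr (flex_fun_val f _); apply: functional_extensionality_dep => i.
  exact: IH.
(* The term is evaluated at [k0] but read at [k]; [hom_rigid_sort] identifies the two images. *)
- rewrite -IH [LHS]transport_rigid [RHS]transport_rigid.
  exact: hom_rigid_sort.
Qed.

Lemma hom_rigid_val (w : world M) (k : nom_term D) (s : Sr)
    (t : hybrid_term k (rigid Sf s)) :
  hom_elt h (hybrid_val M t : elt w (rigid Sf s)) = hybrid_val N t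
    :> rigid_carrier N s.
Proof.
by rewrite -hom_hybrid_val [RHS]transport_rigid; apply: hom_rigid_sort.
Qed.

(** The world [w] is where [hom_rigid_pred] is applied: a nullary rigid predicate atom carries no
    nominal term that names one. *)
Lemma hom_sat_atom (w : world M) (r : atom D) : sat_atom M r -> sat_atom N r.
Proof.
case: r => [k1 k2|n l ks|k s t1 t2|ar p ks t|ar p k t] /=.
- by move=> e; rewrite -!hom_nom_val e.
- move=> /(hom_nom_pred h).
  by congr (nom_pred_val l _); apply: functional_extensionality => i;
    apply: hom_nom_val.
- by move=> e; rewrite -!hom_hybrid_val e.
- move=> /(@hom_rigid_pred _ _ _ _ _ h w).
  by congr (rigid_pred_val p _); apply: functional_extensionality_dep => i;
    apply: hom_rigid_val.
- move=> /(hom_flex_pred h) /(transport_flex_pred (hom_nom_val k)).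
  by congr (flex_pred_val p _); apply: functional_extensionality_dep => i;
    apply: hom_hybrid_val.
Qed.

Lemma hom_action (a : action D) (w w' : world M) :
  action_val a w w' -> action_val a (hom_world h w) (hom_world h w').
Proof.
elim: a w w' => [l|a IHa b IHb|a IHa b IHb|a IHa] w w' /=.
- move=> /(hom_nom_pred h); congr (nom_pred_val l _).
  by apply: functional_extensionality => -[[|[|]]].
- by case=> v [/IHa av /IHb bv]; exists (hom_world h v).
- by case=> [/IHa|/IHb]; [left|right].
- elim=> [x y /IHa xy|x|x y z _ xy _ yz].
  + exact: rt_step.
  + exact: rt_refl.
  + exact: rt_trans xy yz.
Qed.

Lemma hom_sat_premise (w : world M) (p : premise D) :
  sat_premise M p -> sat_premise N p.
Proof.
case: p => [r|a k1 k2] /=; first exact: hom_sat_atom.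
by move=> /hom_action; rewrite !hom_nom_val.
Qed.

(** Serves the binders [Down] and [Forall]. It is transparent, so that its world and element maps
    are convertible to those of [h]. *)
Lemma expand_hom (X : variables Sr)
    (vn : nom_var X -> world M)
    (vr : forall s, rigid_var X s -> rigid_carrier M s)
    (vn' : nom_var X -> world N)
    (vr' : forall s, rigid_var X s -> rigid_carrier N s)
    (hn : forall x, hom_world h (vn x) = vn' x)
    (hr : forall (w : world M) s (x : rigid_var X s),
       hom_elt h (vr s x : elt w (rigid Sf s)) = vr' s x
         :> rigid_carrier N s) :
  hom (expand vn vr) (expand vn' vr').
Proof.
apply: (@Hom _ _ _ (expand vn vr) (expand vn' vr') (hom_world h)
  (fun w s => @hom_elt _ _ _ _ _ h w s)).
- by move=> [|n] [f|x] ws //=; apply: hom_nom_fun.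
- exact: (@hom_nom_pred _ _ _ _ _ h).
- by move=> w [|s0 ar] s [f|x] xs //=; apply: (@hom_rigid_fun _ _ _ _ _ h w).
- exact: (@hom_rigid_pred _ _ _ _ _ h).
- exact: (@hom_flex_fun _ _ _ _ _ h).
- exact: (@hom_flex_pred _ _ _ _ _ h).
- exact: (@hom_rigid_sort _ _ _ _ _ h).
Defined.

End HomPreservation.

(** Says that the map from M to the product of the [N i] is an embedding, without forming the
    product. Over an empty [I] the product is terminal, and all the equations and relations listed
    hold in M. *)
Record jointly_reflecting (Sr Sf : Type) (D : signature Sr Sf) (M : model D)
    (I : Type) (N : I -> model D) (h : forall i, hom M (N i)) : Prop := {
  reflect_world : forall w1 w2 : world M,
    (forall i, hom_world (h i) w1 = hom_world (h i) w2) -> w1 = w2;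
  reflect_nom_pred : forall n (l : nom_pred D n) (ws : 'I_n -> world M),
    (forall i, nom_pred_val l (fun j => hom_world (h i) (ws j))) ->
    nom_pred_val l ws;
  reflect_elt : forall (w : world M) s (x y : elt w s),
    (forall i, hom_elt (h i) x = hom_elt (h i) y) -> x = y;
  reflect_rigid_pred : forall (w : world M) ar (p : rigid_pred D ar)
      (x : forall j, elt w (rigid Sf (arg (ar := ar) j))),
    (forall i, rigid_pred_val p (fun j => hom_elt (h i) (x j))) ->
    rigid_pred_val p x;
  reflect_flex_pred : forall (w : world M) ar (p : flex_pred D ar)
      (x : forall j, elt w (arg (ar := ar) j)),
    (forall i, flex_pred_val p (fun j => hom_elt (h i) (x j))) ->
    flex_pred_val p x
}.

(** The conditions mention only carriers and predicates, and an expansion adds only constants. *)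
Lemma jointly_reflecting_expand (Sr Sf : Type) (D : signature Sr Sf)
    (M : model D) (I : Type) (N : I -> model D) (h : forall i, hom M (N i))
    (X : variables Sr) vn vr vn' vr'
    (hn : forall i x, hom_world (h i) (vn x) = vn' i x)
    (hr : forall i (w : world M) s (x : rigid_var X s),
       hom_elt (h i) (vr s x : elt w (rigid Sf s)) = vr' i s x
         :> rigid_carrier (N i) s) :
  jointly_reflecting h ->
  jointly_reflecting (fun i => expand_hom (vn := vn) (hn i) (hr i)).
Proof.
move=> R; split.
- exact: (reflect_world R).
- exact: (reflect_nom_pred R).
- exact: (reflect_elt R).
- exact: (reflect_rigid_pred R).
- exact: (reflect_flex_pred R).
Qed.

Lemma reflect_sat_atom (Sr Sf : Type) (D : signature Sr Sf) (M : model D)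
    (I : Type) (N : I -> model D) (h : forall i, hom M (N i)) (r : atom D)
    (w : world M) :
  jointly_reflecting h -> (forall i, sat_atom (N i) r) -> sat_atom M r.
Proof.
move=> R; case: r => [k1 k2|n l ks|k s t1 t2|ar p ks t|ar p k t] /= Nr.
- by apply: (reflect_world R) => i; rewrite !hom_nom_val.
- apply: (reflect_nom_pred R) => i; move: (Nr i).
  by congr (nom_pred_val l _); apply: functional_extensionality => j;
    rewrite hom_nom_val.
- apply: (reflect_elt R) => i; move: (Nr i).
  rewrite -!(hom_hybrid_val (h i)).
  (* Both sides are transported along the same equation; destructing it turns the transports into
     identities. *)
  by case: _ / (hom_nom_val (h i) k).
- apply: (reflect_rigid_pred R (w := w)) => i; move: (Nr i).
  by congr (rigid_pred_val p _); apply: functional_extensionality_dep => j;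
    rewrite -(hom_rigid_val (h i) w).
- apply: (reflect_flex_pred R) => i.
  apply/(transport_flex_pred (hom_nom_val (h i) k)); move: (Nr i).
  by congr (flex_pred_val p _); apply: functional_extensionality_dep => j;
    rewrite hom_hybrid_val.
Qed.

(** Premises and action steps pass forward from M to every [N i] by preservation; the atomic head
    comes back by joint reflection. The induction generalizes over the models because binders change
    the signature. *)
Lemma reflect_sat_at (Sr Sf : Type) (D : signature Sr Sf) (g : horn D)
    (M : model D) (I : Type) (N : I -> model D) (h : forall i, hom M (N i))
    (w : world M) :
  jointly_reflecting h ->
  (forall i, sat_at g (hom_world (h i) w)) -> sat_at g w.
Proof.
elim: g M N h w => {D} [D r|D k g IH|D H g IH|D g IH|D X g IH|D a g IH|D f g IH]
  M N h w R /= Ng.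
- exact: reflect_sat_atom w R Ng.
- by apply: (IH _ _ h) => // i; rewrite hom_nom_val.
- move=> MH; apply: (IH _ _ h) => // i; apply: (Ng i) => p /MH.
  exact: (hom_sat_premise (h i)).
- have hr i (v : world M) s (x : void) : hom_elt (h i)
      (match x return elt v (rigid Sf s) with end) =
      match x return rigid_carrier (N i) s with end :> rigid_carrier (N i) s.
    by case: x.
  refine (IH _ _ _ _ (@jointly_reflecting_expand _ _ _ _ _ _ h (one_nominal Sr)
    (fun=> w) (fun s (x : void) => match x with end)
    (fun i=> fun=> hom_world (h i) w)
    (fun i s (x : void) => match x with end) (fun i=> fun=> erefl) hr R) _).
  exact: Ng.
- move=> vn vr.
  (* The clause holds in [N i] under every valuation, in particular under the image of the given
     one. Rigid values are mapped at [w], and [hom_rigid_sort] makes this choice immaterial. *)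
  pose vn' i x := hom_world (h i) (vn x).
  pose vr' i s x :=
    hom_elt (h i) (vr s x : elt w (rigid Sf s)) : rigid_carrier (N i) s.
  have hn i x : hom_world (h i) (vn x) = vn' i x by [].
  have hr i (v : world M) s (x : rigid_var X s) :
      hom_elt (h i) (vr s x : elt v (rigid Sf s)) = vr' i s x
        :> rigid_carrier (N i) s by apply: hom_rigid_sort.
  apply: (IH _ _ _ _ (jointly_reflecting_expand hn hr R)) => i.
  exact: (Ng i (vn' i) (vr' i)).
- move=> w' aw; apply: (IH _ _ h) => // i; apply: (Ng i).
  exact: hom_action aw.
- by apply: (IH _ _ h) => // i; rewrite hom_nom_fun.
Qed.

(** Once worlds and elements are named by terms, each reflection condition becomes an instance of
    [atoms]. *)
Lemma reachable_jointly_reflecting (Sr Sf : Type) (D : signature Sr Sf)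
    (M : model D) (I : Type) (N : I -> model D) (h : forall i, hom M (N i)) :
  reachable M ->
  (forall r, (forall i, sat_atom (N i) r) -> sat_atom M r) ->
  jointly_reflecting h.
Proof.
move=> [nom_reach elt_reach] atoms; split.
- move=> w1 w2; have [k1 <-] := nom_reach w1; have [k2 <-] := nom_reach w2.
  move=> hw; apply: (atoms (NomEq k1 k2)) => i /=.
  by rewrite -!(hom_nom_val (h i)).
- move=> n l ws.
  (* Arities are finite, so naming terms for all arguments can be chosen at once without a choice
     axiom. *)
  have [ks ksE] := fin_all_exists (fun j => nom_reach (ws j)).
  have {ws ksE} <- : (fun j => nom_val M (ks j)) = ws.
    exact: functional_extensionality.
  move=> hw; apply: (atoms (NomPred l ks)) => i /=; move: (hw i).
  by congr (nom_pred_val l _); apply: functional_extensionality => j;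
    apply: hom_nom_val.
- move=> w s; have [k <-] := nom_reach w => x y.
  have [t1 <-] := elt_reach k s x; have [t2 <-] := elt_reach k s y => hxy.
  by apply: (atoms (HybEq t1 t2)) => i /=; rewrite -!(hom_hybrid_val (h i)) hxy.
- move=> w ar p; have [k <-] := nom_reach w => x.
  have [t tE] := fin_all_exists (fun j => elt_reach k _ (x j)).
  have {x tE} <- : (fun j => hybrid_val M (t j)) = x.
    exact: functional_extensionality_dep.
  move=> hx; apply: (atoms (RigidPred p t)) => i /=; move: (hx i).
  by congr (rigid_pred_val p _); apply: functional_extensionality_dep => j;
    apply: hom_rigid_val.
- move=> w ar p; have [k <-] := nom_reach w => x.
  have [t tE] := fin_all_exists (fun j => elt_reach k _ (x j)).
  have {x tE} <- : (fun j => hybrid_val M (t j)) = x.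
    exact: functional_extensionality_dep.
  move=> hx; apply: (atoms (FlexPred p t)) => i /=; move: (hx i).
  move=> /(transport_flex_pred (hom_nom_val (h i) k)).
  by congr (flex_pred_val p _); apply: functional_extensionality_dep => j;
    apply: hom_hybrid_val.
Qed.

Lemma sat_set_atomic_consequences (Sr Sf : Type) (D : signature Sr Sf)
    (G : horn D -> Prop) (N : model D) :
  sat_set N G -> sat_set N (atomic_consequences G).
Proof. by move=> NG _ [r -> /(_ N NG)]. Qed.

Theorem theorem14 (Sr Sf : Type) (D : signature Sr Sf) (G : horn D -> Prop)
    (M : model D) (M_reachable : reachable M)
    (M_initial : initial_model (atomic_consequences G) M) :
  initial_model G M.
Proof.
have [M0 init] := M_initial.
split; last by move=> N /sat_set_atomic_consequences; apply: init.
move=> g Gg w.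
(* Initiality gives only the existence of a homomorphism into each N; indexing by models paired with
   homomorphisms avoids choosing one. *)
pose I := {N : model D & {h : hom M N | sat_set N G}}.
pose h (i : I) : hom M (projT1 i) := sval (projT2 i).
have hG (i : I) : sat_set (projT1 i) G := proj2_sig (projT2 i).
apply: (@reflect_sat_at _ _ _ _ _ _ _ h); last by move=> i; apply: hG.
apply: reachable_jointly_reflecting => // r Nr.
(* By initiality every model of [G] occurs in the family, so [r] is entailed by [G] and is one of
   the atomic consequences that M satisfies. *)
apply: (M0 (Atomic r) _ w); exists r => // N NG _ /=.
have [f _] := init N (sat_set_atomic_consequences NG).
exact: (Nr (existT _ N (exist _ f NG))).
Qed.
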